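(* The space of all fibrations of $\mathbb{R}^3$ by oriented lines deformation retracts to its subspace of trivial fibrations $\mathbb{R}^2\times\mathbb{R}$ (those whose fibers are all parallel with the same oriented direction), and thus has the homotopy type of $S^2$.
   Context: A fibration of $\mathbb{R}^3$ by oriented lines is given by a continuous unit vector field $V:\mathbb{R}^3\to S^2$ all of whose integral curves are oriented straight lines. The space of all such fibrations is the set of such vector fields $V$, with the compact-open topology. A trivial fibration is one for which $V$ is constant. *)

(* Defs.v *)
From HB Require Import structures.
From mathcomp Require Import all_boot all_order all_algebra.
From mathcomp Require Import all_classical all_reals all_analysis.

Set Implicit Arguments.
Unset Strict Implicit.
Unset Printing Implicit Defensive.

Import Order.TTheory GRing.Theory Num.Theory.
Import numFieldNormedType.Exports.

Local Open Scope classical_set_scope.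
Local Open Scope ring_scope.

(* Homotopies are total in the time variable but are constrained, and required
   to be continuous, only on X x [0, 1]. *)
Definition homotopic (R : realType) (X Y : topologicalType) (f g : X -> Y) :=
  exists H : X * R -> Y,
    [/\ {within [set: X] `*` `[0, 1], continuous H},
        forall x, H (x, 0) = f x
      & forall x, H (x, 1) = g x].

Definition homotopy_equivalent (R : realType) (X Y : topologicalType) :=
  exists (f : X -> Y) (g : Y -> X),
    [/\ continuous f, continuous g,
        homotopic R (g \o f) idfun
      & homotopic R (f \o g) idfun].

(* The points of A are fixed throughout the deformation. *)
Definition deformation_retracts_to (R : realType) (X : topologicalType)
    (A : set X) :=
  exists H : X * R -> X,
    [/\ {within [set: X] `*` `[0, 1], continuous H},
        forall x, H (x, 0) = x,
        forall x, A (H (x, 1))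
      & forall (a : X) (t : R), A a -> 0 <= t <= 1 -> H (a, t) = a].

(* The norm of the library on row vectors is the sup norm (it induces the usual
   topology), whence the explicit Euclidean condition. *)
Definition S2 (R : realType) : set 'rV[R]_3 :=
  [set v : 'rV[R]_3 | \sum_(i < 3) v 0 i ^+ 2 = 1].
Arguments S2 : clear implicits.

(* I is meant to be an open interval, so the values of c outside I are
   irrelevant. *)
Definition integral_curve (R : realType) (V : 'rV[R]_3 -> S2 R)
    (I : set R) (c : R -> 'rV[R]_3) :=
  forall t, I t -> is_derive t 1 c (set_val (V (c t))).

Definition straight_on (R : realType) (I : set R) (c : R -> 'rV[R]_3) :=
  exists (p : 'rV[R]_3) (u : S2 R), forall t, I t -> c t = p + t *: set_val u.

(* As V is continuous and bounded, through every point passes an integral curve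
   defined on all of R (Peano), so that the case I = setT yields the fibers,
   which are full lines oriented by V. *)
Definition is_line_fibration (R : realType) (V : 'rV[R]_3 -> S2 R) :=
  continuous V /\
  forall (I : set R) (c : R -> 'rV[R]_3),
    open I -> is_interval I -> integral_curve V I c -> straight_on I c.

Definition vector_fields (R : realType) : topologicalType :=
  {compact-open, 'rV[R]_3 -> S2 R}.

Definition line_fibrations (R : realType) : set (vector_fields R) :=
  [set V | is_line_fibration V].
Arguments line_fibrations : clear implicits.

Definition line_fibration_space (R : realType) : topologicalType :=
  set_type (line_fibrations R).

Definition trivial_fibrations (R : realType) : set (line_fibration_space R) :=
  [set V | exists u : S2 R, forall x : 'rV[R]_3,
    (set_val V : 'rV[R]_3 -> S2 R) x = u].
Arguments trivial_fibrations : clear implicits.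

Definition sphere (R : realType) : topologicalType := set_type (S2 R).

(* Main.v *)
Require Import Defs.
From HB Require Import structures.
From mathcomp Require Import all_boot all_order all_algebra.
From mathcomp Require Import all_classical all_reals all_analysis.

(** Zooming in on the origin makes every line fibration parallel.  If V is a
    fibration by oriented lines, then so is V_s : x |-> V (s x) for each
    s > 0, its lines being those of V scaled by 1/s; and V_0 is the constant
    field V 0, which is a trivial fibration.  As s runs from 1 to 0 the fields
    V_s therefore join V to a trivial fibration inside the space of fibrations,
    and a trivial fibration does not move at all.  This works because the
    topology is the compact-open one: the convergence of V_s to V_0 is only
    asked to be uniform on compact sets, and on a compact set K the continuity
    of V at 0 gives it, since s K shrinks to 0.

    Two points carry the proof.
    - V_s is a line fibration ([is_line_fibration_dilate]): if c is an integral
      curve of V_s, then t |-> s c(t/s) is one of V, hence straight, hence so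
      is c.  At s = 0 the curves have constant velocity, and are straight by
      the mean value theorem ([is_line_fibration_cst]).
    - V_s depends continuously on the pair (V, s) ([continuous_dilation]).
      This is the joint continuity of precomposition by a family of maps with
      a locally compact parameter ([continuous_compact_open_precomp]).

    The same homotopy gives the homotopy type: V |-> V 0 and u |-> (constant
    field u) are continuous maps between the space of fibrations and the sphere,
    the composite on the sphere is the identity, and the other composite is
    V |-> V_0, which V |-> V_s joins to the identity. *)

Set Implicit Arguments.
Unset Strict Implicit.
Unset Printing Implicit Defensive.

Import Order.TTheory GRing.Theory Num.Theory.
Import numFieldNormedType.Exports.

Local Open Scope classical_set_scope.
Local Open Scope ring_scope.

Section curves.
Context (R : realType) (m n : nat).
Implicit Types (t : R) (c : R -> 'M[R]_(m, n)) (u : 'M[R]_(m, n)).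

Lemma is_derive_mxP c t u :
  is_derive t 1 c u <->
  forall i j, is_derive t 1 (fun x => c x i j) (u i j).
Proof.
split=> [[dc <-] i j|dc].
  split; first exact: (derivable_mxP c t 1).1.
  by rewrite (derive_mx dc) mxE.
have dcm : derivable c t 1.
  by apply/derivable_mxP => i j; case: (dc i j).
split=> //; rewrite (derive_mx dcm); apply/matrixP => i j.
by rewrite mxE; case: (dc i j).
Qed.

(** Conjugating a curve by the homothety of ratio s, in space and in time,
    leaves its velocity unchanged; this is what turns the integral curves of
    V (s x) into integral curves of V. *)
Lemma is_derive_rescale c (s t : R) u : s != 0 ->
  is_derive (s^-1 * t) 1 c u ->
  is_derive t 1 (fun x => s *: c (s^-1 * x)) u.
Proof.
move=> s0 /is_derive_mxP dc; apply/is_derive_mxP => i j.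
have dinv : is_derive t 1 (fun x : R => s^-1 * x) s^-1.
  apply: is_derive_eq.
  by rewrite -[_ *: _]/(_ * _) mulr1.
have dcomp := is_derive1_comp (dc i j) dinv.
have -> : (fun x => (s *: c (s^-1 * x)) i j) =
    s \*: ((fun x => c x i j) \o (fun x : R => s^-1 * x)).
  by apply/funext => x; rewrite mxE.
apply: is_derive_eq.
by rewrite -[_ *: _]/(_ * _) mulrCA divff// mulr1.
Qed.

Lemma constant_velocity_affine c (I : set R) u : is_interval I ->
  (forall t, I t -> is_derive t 1 c u) ->
  forall x y, I x -> I y -> c y = c x + (y - x) *: u.
Proof.
move=> itvI dc x y Ix Iy.
wlog xy : x y Ix Iy / x <= y => [wl|].
  have [xy|/ltW yx] := leP x y; first exact: wl.
  by rewrite [c x](wl y x)// -addrA -scalerDl addrA subrK subrr scale0r addr0.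
apply/matrixP => i j; rewrite !mxE; apply/eqP; rewrite addrC -subr_eq; apply/eqP.
have Ixy z : z \in `[x, y] -> I z by rewrite in_itv/=; exact: itvI.
have dcij z : I z -> is_derive z 1 (fun w => c w i j) (u i j).
  by move=> /dc/is_derive_mxP.
have dxy z (zxy : z \in `]x, y[) := dcij z (Ixy z (subset_itv_oo_cc zxy)).
have [z zxy|z _ ->] := MVT_segment xy dxy.
  apply: derivable_within_continuous => w /Ixy Iw.
  by case: (dcij w Iw).
by rewrite mulrC.
Qed.

End curves.

(** At (f, l), a basic neighborhood of f \o phi l asks that a compact K be sent
    into an open O.  By compactness of K, f \o phi l' still sends K into O for
    all l' near l, but a perturbation g of f must be controlled on all the sets
    phi l' K at once: local compactness confines l' to a compact neighborhood,
    over which these sets fill a single compact K', and g is then asked to send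
    K' into O. *)
Lemma continuous_compact_open_precomp (L X Y Z : topologicalType)
    (phi : L -> X -> Y) (f : {compact-open, Y -> Z}) (l : L) :
  locally_compact [set: L] -> regular_space L ->
  continuous (uncurry phi) -> continuous (f : Y -> Z) ->
  {for (f, l), continuous
    (fun p : {compact-open, Y -> Z} * L =>
       (p.1 \o phi p.2 : {compact-open, X -> Z}))}.
Proof.
move=> lcL regL cphi cf.
apply/compact_open_cvgP.
move=> K O cptK oO fKO.
have near_l : \forall l' \near l, K `<=` [set x | O (f (phi l' x))].
  move/compact_near_coveringP : cptK; apply => x Kx.
  have cfphi : continuous (f \o uncurry phi).
    by move=> p; apply: continuous_comp; [exact: cphi|exact: cf].
  have [|[A B] [/= lA xB] AB] := cfphi (l, x) O.
    by apply: open_nbhs_nbhs; split=> //; apply: fKO; exists x.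
  by exists (B, A) => // -[x' l'] [/= Bx' Al']; exact: (AB (l', x')).
(* B provides compactness; cutting it down by closure C keeps the parameters
   where f \o phi l' sends K into O. *)
have [B] := lcL l I; rewrite withinET => Bl [cptB clB].
have [C Cl CP] := regL l _ near_l.
pose K' := (uncurry phi) @` ((B `&` closure C) `*` K).
have cptK' : compact K'.
  apply: continuous_compact; first exact: continuous_subspaceT.
  apply: compact_setX => //; apply: compact_closedI => //.
  exact: closed_closure.
exists ([set g | g @` K' `<=` O], B `&` C).
  split => /=; last exact: filterI.
  apply: open_nbhs_nbhs; split; first exact: compact_open_open.
  by move=> _ [_ [[l' x] [/= [_ Cl'] Kx] <-] <-]; exact: (CP _ Cl').
move=> [g l'] [/= gO [Bl' Cl']] _ [x Kx <-]; apply: gO.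
exists (phi l' x) => //; exists (l', x) => //=; split=> //=; split=> //.
exact: subset_closure.
Qed.

Lemma continuous_compact_open_eval (T U : topologicalType) (x : T) :
  continuous (fun f : {compact-open, T -> U} => (f : T -> U) x).
Proof.
apply/continuousP => O oO; rewrite (_ : _ @^-1` _ =
    [set g : {compact-open, T -> U} | g @` [set x] `<=` O]).
  by apply: compact_open_open => //; exact: compact_set1.
by apply/seteqP; split=> g /=; rewrite image_set1 sub1set inE.
Qed.

Lemma continuous_compact_open_cst (T U : topologicalType) :
  continuous (fun u => cst u : {compact-open, T -> U}).
Proof.
move=> u; apply/compact_open_cvgP => K O _ oO uKO.
have [->|/set0P[x Kx]] := eqVneq K set0.
  by apply: filterE => v _ [y []].
have Ou : O u by apply: uKO; exists x.
by apply: filterS (open_nbhs_nbhs (conj oO Ou)) => v Ov _ [y _ <-].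
Qed.

Section dilations.
Context (R : realType).

Definition dilate (V : 'rV[R]_3 -> S2 R) (s : R) : 'rV[R]_3 -> S2 R :=
  fun x => V (s *: x).

Lemma is_line_fibration_cst (u : S2 R) :
  is_line_fibration (fun _ : 'rV[R]_3 => u).
Proof.
split; first exact: cst_continuous.
move=> I c openI itvI dc.
have [->|/set0P[a Ia]] := eqVneq I set0; first by exists 0, u => t [].
exists (c a - a *: set_val u), u => t It.
rewrite (constant_velocity_affine itvI dc Ia It).
by rewrite scalerBl addrA addrAC.
Qed.

(** A negative ratio is covered as well: a point reflection reverses the
    direction of a line, and the reversal of time in s c(t/s) restores it.
    The whole real line can thus serve as the parameter space of the
    dilations. *)
Lemma is_line_fibration_dilate V s :
  is_line_fibration V -> is_line_fibration (dilate V s).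
Proof.
have [->|s0] := eqVneq s 0.
  move=> _; rewrite (_ : dilate V 0 = fun=> V 0).
    exact: is_line_fibration_cst.
  by apply/funext => x; rewrite /dilate scale0r.
move=> [cV lineV]; split.
  move=> x; apply: continuous_comp; last exact: cV.
  exact: scaler_continuous.
move=> I c openI itvI dc.
pose sI := [set t | I (s^-1 * t)].
have curveV : integral_curve V sI (fun t => s *: c (s^-1 * t)).
  by move=> t It; apply: is_derive_rescale => //; exact: dc.
have opensI : open sI.
  apply: (@open_comp _ _ ( *%R s^-1)) openI => t _.
  exact: mulrl_continuous.
have itvsI : is_interval sI.
  move=> x y Ix Iy z /andP[xz zy]; rewrite /sI/=.
  have [sp|sn] := ltP 0 s^-1.
    by apply: (itvI _ _ Ix Iy); rewrite !ler_pM2l// xz.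
  by apply: (itvI _ _ Iy Ix); rewrite !ler_wnM2l.
have [p [u pu]] := lineV _ _ opensI itvsI curveV.
exists (s^-1 *: p), u => t It.
have /pu : sI (s * t) by rewrite /sI/= mulKf.
rewrite mulKf// => /(congr1 ( *:%R s^-1)).
by rewrite scalerDr !scalerA mulVf// mulKf// scale1r.
Qed.

Local Notation LF := (line_fibration_space R).

(** Uncurried, as a homotopy in the ratio s, from the constant field at s = 0
    to the identity at s = 1. *)
Definition dilation (p : LF * R) : LF :=
  SigSub (mem_set (is_line_fibration_dilate p.2 (set_valP p.1)))
    : set_type (line_fibrations R).

Definition parallel (u : sphere R) : LF :=
  SigSub (mem_set (is_line_fibration_cst u)) : set_type (line_fibrations R).

Definition direction_at0 (V : LF) : sphere R :=
  (set_val V : 'rV[R]_3 -> S2 R) 0.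

Lemma continuous_dilation : continuous dilation.
Proof.
apply: continuous_comp_initial => -[V s].
have cV : continuous (set_val V : 'rV[R]_3 -> S2 R) by case: (set_valP V).
have scaleE : uncurry (fun (s : R) (x : 'rV[R]_3) => s *: x) =
    (fun z => z.1 *: z.2) by apply/funext => -[].
have := @continuous_compact_open_precomp R 'rV[R]_3 'rV[R]_3 (S2 R)
  (fun s x => s *: x) (set_val V) s (@locally_compactR R) uniform_regular.
rewrite scaleE => /(_ (@scale_continuous _ _) cV) cprecomp.
have cforget : {for (V, s), continuous (fun p : LF * R =>
    (set_val p.1, p.2) : vector_fields R * R)}.
  apply: (@cvg_pair _ _ _ _ (nbhs (set_val V : vector_fields R)) (nbhs s));
    last exact: cvg_snd.
  by apply: continuous_comp; [exact: cvg_fst|exact: initial_continuous].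
exact: continuous_comp cforget cprecomp.
Qed.

Lemma continuous_parallel : continuous parallel.
Proof.
by apply: continuous_comp_initial; exact: continuous_compact_open_cst.
Qed.

Lemma continuous_direction_at0 : continuous direction_at0.
Proof.
move=> V.
have cforget : {for V, continuous (set_val : LF -> vector_fields R)}.
  exact: initial_continuous.
have ceval := @continuous_compact_open_eval 'rV[R]_3 (S2 R) 0 (set_val V).
exact: continuous_comp cforget ceval.
Qed.

Lemma dilation1 V : dilation (V, 1) = V.
Proof.
by apply/val_inj/funext => x; rewrite /= /dilate scale1r.
Qed.

Lemma dilation0 V : dilation (V, 0) = parallel (direction_at0 V).
Proof.
by apply/val_inj/funext => x; rewrite /= /dilate scale0r.
Qed.

Lemma dilation_trivial V s : trivial_fibrations R V -> dilation (V, s) = V.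
Proof.
move=> [u Vu]; apply/val_inj/funext => x.
exact: etrans (Vu (s *: x)) (esym (Vu x)).
Qed.

End dilations.

Theorem theorem5 (R : realType) :
  deformation_retracts_to R (trivial_fibrations R) /\
  homotopy_equivalent R (line_fibration_space R) (sphere R).
Proof.
split.
  exists (fun p => dilation (p.1, 1 - p.2)); split => [|V|V|V t Vtriv _] /=.
  - apply: continuous_subspaceT => p.
    have cflip : {for p, continuous (fun p : line_fibration_space R * R =>
        (p.1, 1 - p.2) : line_fibration_space R * R)}.
      apply: (@cvg_pair _ _ _ _ (nbhs p.1) (nbhs (1 - p.2))).
        exact: cvg_fst.
      by apply: cvgB; [exact: cvg_cst|exact: cvg_snd].
    exact: continuous_comp cflip (@continuous_dilation R _).
  - by rewrite subr0 dilation1.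
  - by rewrite subrr dilation0; exists (direction_at0 V).
  - exact: dilation_trivial.
exists (@direction_at0 R), (@parallel R); split.
- exact: continuous_direction_at0.
- exact: continuous_parallel.
- exists (@dilation R); split=> [|V|V].
  + exact/continuous_subspaceT/continuous_dilation.
  + exact: dilation0.
  + exact: dilation1.
- exists fst; split=> //.
  by apply: continuous_subspaceT => p; exact: cvg_fst.
Qed.
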